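(* Let $a\in(0,1)$ and $F\in\Gamma_0^s(\mathbb{R}_+)$, and suppose $\hat F^a$ is a metric on $[0,+\infty)$. Then the sequence $\{T_a^{(n)}(F)\}_n$ is pointwise increasing and converges pointwise to a function $F^\infty$ which is a fixed point of $T_a$. Moreover, if $(\widehat{F^\infty})^a$ is a metric on $[0,+\infty)$, then $F^\infty(s)=c|s^a-1|^{1/a}$ for some $c\in(0,+\infty)$.
   Context: $\Gamma_0(\mathbb{R}_+)$ is the set of functions $F:[0,\infty)\to[0,\infty]$ that are convex, lower semicontinuous, with $F(1)=0$. For $F\in\Gamma_0(\mathbb{R}_+)$: $\mathrm{rec}(F)(r)=\lim_{\alpha\to\infty}F(1+\alpha r)/\alpha$, $F'_\infty:=\mathrm{rec}(F)(1)$; the perspective function is $\hat F(r,t)=tF(r/t)$ for $t>0$, $\hat F(r,0)=\mathrm{rec}(F)(r)$; the reverse entropy is $R(s)=sF(1/s)$ for $s>0$, $R(0)=F'_\infty$. $\Gamma_0^s(\mathbb{R}_+)$ is the set of $F\in\Gamma_0(\mathbb{R}_+)$ with $F=R$; for such $F$, $\hat F$ is symmetric and $\hat F(1,t)=F(t)$. The marginal perspective function $H_F$ is the lower semicontinuous envelope of $\tilde H_F(r_1,r_2)=\inf_{\theta>0}[\hat F(\theta,r_1)+\hat F(\theta,r_2)]$. For $a\in(0,1]$, $T_a:\Gamma_0(\mathbb{R}_+)\to\Gamma_0^s(\mathbb{R}_+)$ is $T_a(F)(s)=2^{1/a-1}H_F(1,s)$, and $T_a^{(n)}$ is its $n$-th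 iterate. A metric on $[0,\infty)$ is a finite-valued function $D:[0,\infty)^2\to[0,\infty)$ with $D(x,y)=0\iff x=y$, symmetric, satisfying the triangle inequality. *)

(* Defs.v *)
From Stdlib Require Import Reals Lra ClassicalEpsilon.
Open Scope R_scope.

Inductive ER : Type := Fin (r : R) | PInf.

Definition ER_le (x y : ER) : Prop :=
  match x, y with
  | Fin a, Fin b => a <= b
  | _, PInf => True
  | PInf, Fin _ => False
  end.

Definition ER_lt (x y : ER) : Prop := ER_le x y /\ x <> y.

Definition ER_add (x y : ER) : ER :=
  match x, y with
  | Fin a, Fin b => Fin (a + b)
  | _, _ => PInf
  end.

(** scalar multiplication, used only with positive scalars (t * oo = oo) *)
Definition ER_scal (t : R) (x : ER) : ER :=
  match x with
  | Fin a => Fin (t * a)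
  | PInf => PInf
  end.

(** Real power x^a for x >= 0, a > 0, with 0^a = 0. *)
Definition rpow (x a : R) : R :=
  if Rle_dec x 0 then 0 else Rpower x a.

Definition ER_pow (e : ER) (a : R) : ER :=
  match e with
  | Fin r => Fin (rpow r a)
  | PInf => PInf
  end.

Definition toR (e : ER) : R :=
  match e with Fin r => r | PInf => 0 end.

Definition ER_lim_infty (g : R -> ER) (l : ER) : Prop :=
  match l with
  | Fin L => forall eps, 0 < eps -> exists M, forall alpha, M < alpha ->
               exists y, g alpha = Fin y /\ Rabs (y - L) < eps
  | PInf => forall K, exists M, forall alpha, M < alpha -> ER_lt (Fin K) (g alpha)
  end.

Definition Lim_infty (g : R -> ER) : ER :=
  epsilon (inhabits PInf) (ER_lim_infty g).

Definition ER_seq_lim (u : nat -> ER) (l : ER) : Prop :=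
  match l with
  | Fin L => forall eps, 0 < eps -> exists N, forall n, (N <= n)%nat ->
               exists y, u n = Fin y /\ Rabs (y - L) < eps
  | PInf => forall K, exists N, forall n, (N <= n)%nat -> ER_lt (Fin K) (u n)
  end.

Definition ER_is_glb (P : ER -> Prop) (m : ER) : Prop :=
  (forall x, P x -> ER_le m x) /\
  (forall m', (forall x, P x -> ER_le m' x) -> ER_le m' m).

Definition ER_is_lub (P : ER -> Prop) (m : ER) : Prop :=
  (forall x, P x -> ER_le x m) /\
  (forall m', (forall x, P x -> ER_le x m') -> ER_le m m').

Definition ER_inf (P : ER -> Prop) : ER := epsilon (inhabits PInf) (ER_is_glb P).
Definition ER_sup (P : ER -> Prop) : ER := epsilon (inhabits PInf) (ER_is_lub P).

(** Functions F : [0,oo) -> [0,oo], represented as R -> ER, only values on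
    [0,oo) matter. *)
Definition nonneg_ER (F : R -> ER) : Prop :=
  forall x, 0 <= x -> ER_le (Fin 0) (F x).

Definition convex_ER (F : R -> ER) : Prop :=
  forall x y l, 0 <= x -> 0 <= y -> 0 < l < 1 ->
    ER_le (F (l * x + (1 - l) * y))
          (ER_add (ER_scal l (F x)) (ER_scal (1 - l) (F y))).

Definition lsc_ER (F : R -> ER) : Prop :=
  forall x, 0 <= x -> forall c, ER_lt (Fin c) (F x) ->
    exists d, 0 < d /\ forall y, 0 <= y -> Rabs (y - x) < d -> ER_lt (Fin c) (F y).

Definition Gamma0 (F : R -> ER) : Prop :=
  nonneg_ER F /\ convex_ER F /\ lsc_ER F /\ F 1 = Fin 0.

Definition recF (F : R -> ER) (r : R) : ER :=
  Lim_infty (fun alpha => ER_scal (/ alpha) (F (1 + alpha * r))).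

Definition Fp_infty (F : R -> ER) : ER := recF F 1.

Definition persp (F : R -> ER) (r t : R) : ER :=
  if Rlt_dec 0 t then ER_scal t (F (r / t)) else recF F r.

Definition rev_ent (F : R -> ER) (s : R) : ER :=
  if Rlt_dec 0 s then ER_scal s (F (/ s)) else Fp_infty F.

Definition Gamma0s (F : R -> ER) : Prop :=
  Gamma0 F /\ forall s, 0 <= s -> F s = rev_ent F s.

Definition Htilde (F : R -> ER) (r1 r2 : R) : ER :=
  ER_inf (fun v => exists theta, 0 < theta /\
                     v = ER_add (persp F theta r1) (persp F theta r2)).

Definition lsc2_ER (g : R -> R -> ER) : Prop :=
  forall x1 x2, 0 <= x1 -> 0 <= x2 -> forall c, ER_lt (Fin c) (g x1 x2) ->
    exists d, 0 < d /\ forall y1 y2, 0 <= y1 -> 0 <= y2 ->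
      Rabs (y1 - x1) < d -> Rabs (y2 - x2) < d -> ER_lt (Fin c) (g y1 y2).

Definition HF (F : R -> ER) (r1 r2 : R) : ER :=
  ER_sup (fun v => exists g : R -> R -> ER, lsc2_ER g /\
            (forall y1 y2, 0 <= y1 -> 0 <= y2 -> ER_le (g y1 y2) (Htilde F y1 y2)) /\
            v = g r1 r2).

Definition Ta (a : R) (F : R -> ER) : R -> ER :=
  fun s => ER_scal (Rpower 2 (1 / a - 1)) (HF F 1 s).

Definition Ta_iter (a : R) (n : nat) (F : R -> ER) : R -> ER :=
  Nat.iter n (Ta a) F.

Definition is_metric_nonneg (D : R -> R -> R) : Prop :=
  (forall x y, 0 <= x -> 0 <= y -> 0 <= D x y) /\
  (forall x y, 0 <= x -> 0 <= y -> (D x y = 0 <-> x = y)) /\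
  (forall x y, 0 <= x -> 0 <= y -> D x y = D y x) /\
  (forall x y z, 0 <= x -> 0 <= y -> 0 <= z -> D x z <= D x y + D y z).

Definition ER_metric (D : R -> R -> ER) : Prop :=
  (forall x y, 0 <= x -> 0 <= y -> D x y <> PInf) /\
  is_metric_nonneg (fun x y => toR (D x y)).

(* Main.v *)
Require Import Defs.
From Stdlib Require Import Reals Lra Lia Classical ClassicalEpsilon.
Open Scope R_scope.

(* On the cone [0,oo)^2 the perspective of F is a "cost": symmetric, 1-homogeneous,
   subadditive, lower semicontinuous and zero on the diagonal.  A cost G grows when a point
   moves away from the diagonal, so the infimum over t of G(t,x) + G(t,y) runs over a compact
   interval; hence it is attained, is again a cost, needs no lower semicontinuous envelope,
   and commutes with increasing limits.  The triangle inequality for G^a together with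
   concavity of the power a gives F <= T_a F, so the iterates increase by monotonicity of T_a,
   and their supremum is a fixed point.

   If H is the cost of a fixed point and H^a is a metric, equality in the concavity estimate makes the
   minimiser a metric midpoint.  As the distance to 0 is H(0,1)^a x^a, a midpoint of (x, 1)
   with x on a geodesic from 0 to 1 lies on that geodesic too.  Starting from 0, such points
   accumulate at 1; by homogeneity their products are again geodesic points, so they are
   dense in [0,1], and lower semicontinuity gives H(x,1)^a = H(0,1)^a (1 - x^a). *)

(** * Order and arithmetic of extended reals *)

Lemma ER_lt_Fin c e :
  ER_lt (Fin c) e <-> match e with Fin r => c < r | PInf => True end.
Proof.
unfold ER_lt; destruct e as [r|]; simpl; split; try tauto.
- intros [h1 h2]; destruct h1 as [h1|h1]; [easy|subst; now destruct h2].
- intros h; split; [lra|]; intros e; injection e; lra.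
- intros _; split; [easy|discriminate].
Qed.

Lemma ER_le_refl x : ER_le x x.
Proof. destruct x; simpl; auto with real. Qed.

Lemma ER_le_trans y x z : ER_le x y -> ER_le y z -> ER_le x z.
Proof. destruct x, y, z; simpl; try tauto; lra. Qed.

Lemma ER_le_antisym x y : ER_le x y -> ER_le y x -> x = y.
Proof. destruct x, y; simpl; try tauto; intros; f_equal; lra. Qed.

Lemma ER_add_comm x y : ER_add x y = ER_add y x.
Proof. destruct x, y; simpl; trivial; f_equal; lra. Qed.

Lemma ER_add_0_l x : ER_add (Fin 0) x = x.
Proof. destruct x; simpl; trivial; f_equal; lra. Qed.

Lemma ER_add_0_r x : ER_add x (Fin 0) = x.
Proof. now rewrite ER_add_comm, ER_add_0_l. Qed.

Lemma ER_add_le x y x' y' :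
  ER_le x x' -> ER_le y y' -> ER_le (ER_add x y) (ER_add x' y').
Proof. destruct x, y, x', y'; simpl; try tauto; lra. Qed.

Lemma ER_add_nonneg x y :
  ER_le (Fin 0) x -> ER_le (Fin 0) y -> ER_le (Fin 0) (ER_add x y).
Proof. destruct x, y; simpl; try tauto; lra. Qed.

Lemma ER_le_add_l x y : ER_le (Fin 0) y -> ER_le x (ER_add x y).
Proof. destruct x, y; simpl; try tauto; lra. Qed.

Lemma ER_le_add_r x y : ER_le (Fin 0) y -> ER_le x (ER_add y x).
Proof. rewrite ER_add_comm; apply ER_le_add_l. Qed.

Lemma ER_add_swap x y z t :
  ER_add (ER_add x y) (ER_add z t) = ER_add (ER_add x z) (ER_add y t).
Proof. destruct x, y, z, t; simpl; trivial; f_equal; lra. Qed.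

Lemma ER_scal_le t x y : 0 < t -> ER_le x y -> ER_le (ER_scal t x) (ER_scal t y).
Proof.
intros ht; destruct x, y; simpl; try tauto.
intros h; apply Rmult_le_compat_l; lra.
Qed.

Lemma ER_scal_add t x y :
  ER_scal t (ER_add x y) = ER_add (ER_scal t x) (ER_scal t y).
Proof. destruct x, y; simpl; trivial; f_equal; lra. Qed.

Lemma ER_scal_scal s t x : ER_scal s (ER_scal t x) = ER_scal (s * t) x.
Proof. destruct x; simpl; trivial; f_equal; lra. Qed.

Lemma ER_scal_1 x : ER_scal 1 x = x.
Proof. destruct x; simpl; trivial; f_equal; lra. Qed.

Lemma ER_scal_nonneg t x : 0 < t -> ER_le (Fin 0) x -> ER_le (Fin 0) (ER_scal t x).
Proof. intros ht; destruct x; simpl; trivial; intros h; apply Rmult_le_pos; lra. Qed.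

Lemma ER_scal_le_self t x : 0 < t <= 1 -> ER_le (Fin 0) x -> ER_le (ER_scal t x) x.
Proof. intros ht; destruct x; simpl; trivial; intros h; nra. Qed.

Lemma ER_lt_scal t c x :
  0 < t -> ER_lt (Fin c) (ER_scal t x) <-> ER_lt (Fin (c / t)) x.
Proof.
intros ht; rewrite !ER_lt_Fin; destruct x as [r|]; simpl; [|tauto].
replace (c < t * r) with (t * (c / t) < t * r) by (f_equal; field; lra).
split; intros h.
- now apply Rmult_lt_reg_l with t.
- now apply Rmult_lt_compat_l.
Qed.

Lemma ER_le_of_lt x y : (forall c, ER_lt (Fin c) x -> ER_le (Fin c) y) -> ER_le x y.
Proof.
intros h; destruct y as [y|]; [|now destruct x].
destruct x as [x|]; simpl.
- apply Rnot_lt_le; intros hlt.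
  specialize (h ((x + y) / 2)); rewrite ER_lt_Fin in h; simpl in h; lra.
- specialize (h (y + 1)); rewrite ER_lt_Fin in h; simpl in h; specialize (h I); lra.
Qed.

Lemma ER_not_le x c : ~ ER_le x (Fin c) -> ER_lt (Fin c) x.
Proof. rewrite ER_lt_Fin; destruct x; simpl; [lra|trivial]. Qed.

Lemma ER_lt_le_trans c x y : ER_lt (Fin c) x -> ER_le x y -> ER_lt (Fin c) y.
Proof. rewrite !ER_lt_Fin; destruct x, y; simpl; try tauto; lra. Qed.

Lemma ER_le_lt_Fin c c' x : c < c' -> ER_le (Fin c') x -> ER_lt (Fin c) x.
Proof. rewrite ER_lt_Fin; destruct x; simpl; trivial; lra. Qed.

Lemma ER_lt_dense c x : ER_lt (Fin c) x -> exists c', c < c' /\ ER_lt (Fin c') x.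
Proof.
destruct x as [x|]; rewrite ER_lt_Fin; intros h.
- exists ((c + x) / 2); rewrite ER_lt_Fin; lra.
- exists (c + 1); rewrite ER_lt_Fin; split; [lra|trivial].
Qed.

(** The gap between [c] and the sum can be shared between the summands; in this form lower
    semicontinuity passes from two functions to their sum. *)
Lemma ER_lt_add c x y :
  ER_lt (Fin c) (ER_add x y) <->
  exists c1 c2, ER_lt (Fin c1) x /\ ER_lt (Fin c2) y /\ c <= c1 + c2.
Proof.
split.
- rewrite ER_lt_Fin; destruct x as [x|], y as [y|]; simpl; intros h.
  + exists (x - (x + y - c) / 2), (y - (x + y - c) / 2); rewrite !ER_lt_Fin; lra.
  + exists (x - 1), (c - x + 1); rewrite !ER_lt_Fin; lra.
  + exists (c - y + 1), (y - 1); rewrite !ER_lt_Fin; lra.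
  + exists c, 0; rewrite !ER_lt_Fin; lra.
- intros [c1 [c2 [h1 [h2 h3]]]]; rewrite ER_lt_Fin in *.
  destruct x as [x|], y as [y|]; simpl; trivial; lra.
Qed.

(** * Infima and suprema of sets of extended reals *)

Lemma ER_infP (P : ER -> Prop) :
  (forall v, P v -> ER_le (Fin 0) v) -> ER_is_glb P (ER_inf P).
Proof.
intros hP; unfold ER_inf; apply epsilon_spec.
(* [completeness] is about suprema, hence the reflection of [z] to [- z]. A set without finite
   values, empty or not, has infimum [PInf]. *)
destruct (classic (exists r, P (Fin r))) as [[r0 hr0]|hn].
- destruct (completeness (fun z => P (Fin (- z)))) as [m [m1 m2]].
  + exists 0; intros z hz; apply hP in hz; simpl in hz; lra.
  + exists (- r0); now rewrite Ropp_involutive.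
  + exists (Fin (- m)); split.
    * intros [v|] hv; simpl; trivial.
      assert (- v <= m) by (apply m1; now rewrite Ropp_involutive); lra.
    * intros [m'|] hm; simpl.
      -- enough (m <= - m') by lra.
         apply m2; intros z hz; apply hm in hz; simpl in hz; lra.
      -- now apply hm in hr0.
- exists PInf; split.
  + intros [v|] hv; simpl; trivial; apply hn; now exists v.
  + now intros [m'|].
Qed.

Lemma ER_glb_add_Fin P m c w :
  ER_is_glb P m -> (forall v, P v -> ER_le (Fin c) (ER_add v w)) ->
  ER_le (Fin c) (ER_add m w).
Proof.
intros hm h; destruct w as [w|]; [|now destruct m].
assert (hle : ER_le (Fin (c - w)) m).
{ apply hm; intros v hv; specialize (h v hv); destruct v; simpl in *; trivial; lra. }
destruct m; simpl in *; trivial; lra.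
Qed.

(** The two infima run over independent variables, so they are taken one after the other, once [e]
    has been replaced by real numbers below it. *)
Lemma ER_glb_add P Q m m' e :
  ER_is_glb P m -> ER_is_glb Q m' ->
  (forall v w, P v -> Q w -> ER_le e (ER_add v w)) -> ER_le e (ER_add m m').
Proof.
intros hm hm' h; apply ER_le_of_lt; intros c [hc _].
apply (ER_glb_add_Fin P m c m' hm); intros v hv; rewrite ER_add_comm.
apply (ER_glb_add_Fin Q m' c v hm'); intros w hw; rewrite ER_add_comm.
apply ER_le_trans with (1 := hc); auto.
Qed.

(** Nonemptiness matters: [ER] has no least element that could be the supremum of the empty set. *)
Lemma ER_supP (P : ER -> Prop) : (exists v, P v) -> ER_is_lub P (ER_sup P).
Proof.
intros [v0 hv0]; unfold ER_sup; apply epsilon_spec.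
destruct (classic (exists K, forall v, P v -> ER_le v (Fin K))) as [[K hK]|hn].
- destruct (completeness (fun z => P (Fin z))) as [m [m1 m2]].
  + exists K; intros z hz; now apply hK in hz.
  + destruct v0 as [v0|]; [now exists v0|now apply hK in hv0].
  + exists (Fin m); split.
    * intros [v|] hv; simpl; [now apply m1|now apply hK in hv].
    * intros [m'|] hm; simpl; trivial.
      apply m2; intros z hz; now apply hm in hz.
- exists PInf; split.
  + now intros [v|].
  + intros [m'|] hm; simpl; trivial; apply hn; now exists m'.
Qed.

Lemma ER_sup_eq (P : ER -> Prop) m : ER_is_lub P m -> ER_sup P = m.
Proof.
intros hm.
assert (h : ER_is_lub P (ER_sup P)) by (unfold ER_sup; apply epsilon_spec; now exists m).
destruct hm as [m1 m2], h as [h1 h2]; apply ER_le_antisym; auto.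
Qed.

Lemma ER_lt_lub (P : ER -> Prop) m c :
  ER_is_lub P m -> ER_lt (Fin c) m -> exists v, P v /\ ER_lt (Fin c) v.
Proof.
intros [_ h2] hc; apply NNPP; intros hn.
assert (h : ER_le m (Fin c)).
{ apply h2; intros v hv; apply NNPP; intros hv'; apply hn; exists v; split; trivial.
  now apply ER_not_le. }
rewrite ER_lt_Fin in hc; destruct m; simpl in *; [lra|trivial].
Qed.

(** * Limits in [ER] and compactness of intervals *)

Lemma ER_lim_infty_unique g l l' :
  ER_lim_infty g l -> ER_lim_infty g l' -> l = l'.
Proof.
assert (hF : forall a b : R, ER_lim_infty g (Fin a) -> ER_lim_infty g (Fin b) -> ~ a < b).
{ intros u v hu hv huv.
  destruct (hu ((v - u) / 2)) as [M1 h1]; [lra|].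
  destruct (hv ((v - u) / 2)) as [M2 h2]; [lra|].
  pose proof (Rmax_l M1 M2); pose proof (Rmax_r M1 M2).
  destruct (h1 (Rmax M1 M2 + 1)) as [y [e hy]]; [lra|].
  destruct (h2 (Rmax M1 M2 + 1)) as [z [e' hz]]; [lra|].
  rewrite e in e'; injection e'; intros; subst z.
  apply Rabs_def2 in hy, hz; lra. }
assert (hI : forall b : R, ER_lim_infty g PInf -> ER_lim_infty g (Fin b) -> False).
{ intros v hu hv.
  destruct (hu (v + 1)) as [M1 h1].
  destruct (hv 1) as [M2 h2]; [lra|].
  pose proof (Rmax_l M1 M2); pose proof (Rmax_r M1 M2).
  specialize (h1 (Rmax M1 M2 + 1)).
  destruct (h2 (Rmax M1 M2 + 1)) as [z [e' hz]]; [lra|].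
  rewrite e', ER_lt_Fin in h1; apply Rabs_def2 in hz; lra. }
intros h h'; destruct l as [l|], l' as [l'|]; trivial.
- f_equal; apply Rle_antisym; apply Rnot_lt_le; auto.
- exfalso; eauto.
- exfalso; eauto.
Qed.

(** [Lim_infty] is a choice by [epsilon]; uniqueness of limits identifies it with any limit that has
    been found. *)
Lemma Lim_infty_eq g l : ER_lim_infty g l -> Lim_infty g = l.
Proof.
intros h; apply ER_lim_infty_unique with (g := g); trivial.
unfold Lim_infty; apply epsilon_spec; now exists l.
Qed.

Lemma ER_seq_lim_increasing (u : nat -> ER) l :
  (forall n, ER_le (u n) (u (S n))) -> ER_is_lub (fun v => exists n, v = u n) l ->
  ER_seq_lim u l.
Proof.
intros hinc hl.
assert (hmono : forall n m, (n <= m)%nat -> ER_le (u n) (u m)).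
{ intros n m hnm; induction hnm; [apply ER_le_refl|].
  now apply ER_le_trans with (u m). }
destruct l as [l|]; simpl.
- intros eps heps.
  destruct (ER_lt_lub _ _ (l - eps) hl) as [v [[N ->] hN]]; [rewrite ER_lt_Fin; lra|].
  exists N; intros n hn.
  pose proof (ER_lt_le_trans _ _ _ hN (hmono _ _ hn)) as h.
  assert (h' : ER_le (u n) (Fin l)) by (apply hl; now exists n).
  rewrite ER_lt_Fin in h; destruct (u n) as [y|]; [|easy].
  exists y; split; trivial; simpl in h'; apply Rabs_def1; lra.
- intros K.
  destruct (ER_lt_lub _ _ K hl) as [v [[N ->] hN]]; [now rewrite ER_lt_Fin|].
  exists N; intros n hn; exact (ER_lt_le_trans _ _ _ hN (hmono _ _ hn)).
Qed.

(* Heine-Borel in the form "a property of sets that is local and stable under subsets and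
   binary unions holds on compact intervals". *)
Lemma interval_compact (Q : (R -> Prop) -> Prop) b :
  0 <= b ->
  (forall A B : R -> Prop, (forall x, A x -> B x) -> Q B -> Q A) ->
  (forall A B : R -> Prop, Q A -> Q B -> Q (fun x => A x \/ B x)) ->
  (forall x, 0 <= x -> exists d, 0 < d /\ Q (fun y => 0 <= y /\ Rabs (y - x) < d)) ->
  Q (fun y => 0 <= y <= b).
Proof.
intros hb hsub hun hloc.
destruct (completeness (fun t => 0 <= t <= b /\ Q (fun y => 0 <= y <= t))) as [s [s1 s2]].
- exists b; intros t ht; lra.
- exists 0; split; [lra|].
  destruct (hloc 0) as [d [hd hQ]]; [lra|].
  apply hsub with (2 := hQ); intros y hy; split; [lra|].
  apply Rabs_def1; lra.
- assert (hs0 : 0 <= s).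
  { apply s1; split; [lra|].
    destruct (hloc 0) as [d [hd hQ]]; [lra|].
    apply hsub with (2 := hQ); intros y hy; split; [lra|].
    apply Rabs_def1; lra. }
  destruct (hloc s hs0) as [d [hd hQ]].
  assert (ht : exists t, s - d < t /\ 0 <= t <= b /\ Q (fun y => 0 <= y <= t)).
  { apply NNPP; intros hn.
    enough (s <= s - d) by lra.
    apply s2; intros t ht; apply Rnot_lt_le; intros h; apply hn; now exists t. }
  destruct ht as [t [ht1 [ht2 ht3]]].
  (* The interval up to [t] and the neighbourhood of [s] cover this one. As it cannot reach beyond
     the supremum [s], the minimum must be [b]. *)
  assert (hQ' : Q (fun y => 0 <= y <= Rmin b (s + d / 2))).
  { apply hsub with (2 := hun _ _ ht3 hQ); intros y hy.
    assert (y <= s + d / 2) by (pose proof (Rmin_r b (s + d / 2)); lra).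
    destruct (Rle_dec y t); [left; lra|right].
    split; [lra|apply Rabs_def1; lra]. }
  assert (h : Rmin b (s + d / 2) <= s).
  { apply s1; split; trivial; split; [|apply Rmin_l].
    apply Rmin_glb; lra. }
  revert h hQ'; unfold Rmin; destruct (Rle_dec b (s + d / 2)); trivial; intros; lra.
Qed.

(** * Symmetric perspective costs *)

(** Homogeneity and subadditivity together encode joint convexity. In two variables the recession
    values [G 0 x] are ordinary values, and the class is stable under scaling, midpoint infima and
    suprema of sequences. *)
Record cost (G : R -> R -> ER) : Prop := {
  cost_nonneg : forall x y, 0 <= x -> 0 <= y -> ER_le (Fin 0) (G x y);
  cost_sym : forall x y, 0 <= x -> 0 <= y -> G x y = G y x;
  cost_hom : forall t x y, 0 < t -> 0 <= x -> 0 <= y ->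
    G (t * x) (t * y) = ER_scal t (G x y);
  cost_subadd : forall x y x' y', 0 <= x -> 0 <= y -> 0 <= x' -> 0 <= y' ->
    ER_le (G (x + x') (y + y')) (ER_add (G x y) (G x' y'));
  cost_lsc : lsc2_ER G;
  cost_diag : forall x, 0 <= x -> G x x = Fin 0 }.

(** The reverse inequality is the given one with factor [/ t] at the scaled point. *)
Lemma hom_of_le (G : R -> R -> ER) :
  (forall t x y, 0 < t -> 0 <= x -> 0 <= y ->
    ER_le (G (t * x) (t * y)) (ER_scal t (G x y))) ->
  forall t x y, 0 < t -> 0 <= x -> 0 <= y -> G (t * x) (t * y) = ER_scal t (G x y).
Proof.
intros hhom t x y ht hx hy; apply ER_le_antisym; auto.
assert (0 < / t) by now apply Rinv_0_lt_compat.
assert (0 <= t * x) by (apply Rmult_le_pos; lra).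
assert (0 <= t * y) by (apply Rmult_le_pos; lra).
assert (h : ER_le (G (/ t * (t * x)) (/ t * (t * y)))
                  (ER_scal (/ t) (G (t * x) (t * y)))) by auto.
apply ER_scal_le with (1 := ht) in h.
rewrite ER_scal_scal, <- !Rmult_assoc, Rinv_r, Rinv_l, ER_scal_1, !Rmult_1_l in h by lra.
trivial.
Qed.

(** The added diagonal vector (t, t) has cost 0. *)
Lemma cost_shift G x y t :
  cost G -> 0 <= x -> 0 <= y -> 0 <= t -> ER_le (G (x + t) (y + t)) (G x y).
Proof.
intros hG hx hy ht.
rewrite <- (ER_add_0_r (G x y)), <- (cost_diag G hG t ht).
now apply cost_subadd.
Qed.

(** The point (t, x) is l (t', x) plus the diagonal vector (1 - l) (x, x), so its cost is at most l
    times that of (t', x), with l <= 1. *)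
Lemma cost_mono G x t t' :
  cost G -> 0 <= x <= t -> t <= t' -> ER_le (G t x) (G t' x).
Proof.
intros hG hx ht.
destruct (Req_dec t x) as [->|htx].
{ rewrite (cost_diag G hG x) by lra; apply cost_nonneg; lra || trivial. }
set (l := (t - x) / (t' - x)).
assert (hl : 0 < l <= 1).
{ unfold l; split; [apply Rdiv_lt_0_compat; lra|].
  apply Rmult_le_reg_r with (t' - x); [lra|]; field_simplify; lra. }
assert (e : t = l * t' + (1 - l) * x) by (unfold l; field; lra).
apply ER_le_trans with (ER_scal l (G t' x)).
- rewrite <- (cost_hom G hG) by lra.
  rewrite e at 1; replace x with (l * x + (1 - l) * x) at 2 by ring.
  apply cost_shift; trivial; nra.
- apply ER_scal_le_self; trivial; apply cost_nonneg; lra || trivial.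
Qed.

(** The point (y, x) is (y - x, 0) shifted diagonally by x; monotonicity then raises y - x to y. *)
Lemma cost_le_axis G x y : cost G -> 0 <= x <= y -> ER_le (G x y) (G 0 y).
Proof.
intros hG hxy; rewrite (cost_sym G hG 0 y) by lra.
apply ER_le_trans with (G (y - x) 0); [|apply cost_mono; trivial; lra].
rewrite (cost_sym G hG x y) by lra.
pose proof (cost_shift G (y - x) 0 x hG) as h.
replace (y - x + x) with y in h by ring; rewrite Rplus_0_l in h; apply h; lra.
Qed.

Lemma cost_scal G k : 0 < k -> cost G -> cost (fun x y => ER_scal k (G x y)).
Proof.
intros hk hG; split.
- intros x y hx hy; apply ER_scal_nonneg; trivial; now apply cost_nonneg.
- intros x y hx hy; now rewrite cost_sym.
- intros t x y ht hx hy; rewrite cost_hom by trivial.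
  rewrite !ER_scal_scal; f_equal; ring.
- intros x y x' y' hx hy hx' hy'.
  rewrite <- ER_scal_add; apply ER_scal_le; trivial; now apply cost_subadd.
- intros x1 x2 h1 h2 c hc; apply ER_lt_scal in hc; trivial.
  destruct (cost_lsc G hG x1 x2 h1 h2 _ hc) as [d [hd h]].
  exists d; split; trivial; intros; apply ER_lt_scal; auto.
- intros x hx; rewrite cost_diag by trivial; simpl; f_equal; ring.
Qed.

(** By homogeneity the difference quotient is [G] at (0, x) shifted diagonally by [/ al]. Such
    shifts do not increase the cost, and lower semicontinuity bounds it from below as the shift
    tends to 0. *)
Lemma recF_cost F G x :
  cost G -> (forall s, 0 <= s -> F s = G 1 s) -> 0 <= x -> recF F x = G 0 x.
Proof.
intros hG hF hx; apply Lim_infty_eq.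
assert (hval : forall al, 0 < al ->
  ER_scal (/ al) (F (1 + al * x)) = G (0 + / al) (x + / al)).
{ intros al hal.
  assert (0 < / al) by now apply Rinv_0_lt_compat.
  assert (0 <= al * x) by (apply Rmult_le_pos; lra).
  rewrite hF, <- (cost_hom G hG) by lra.
  f_equal; field; lra. }
assert (hup : forall al, 0 < al -> ER_le (ER_scal (/ al) (F (1 + al * x))) (G 0 x)).
{ intros al hal; rewrite hval by trivial.
  assert (0 < / al) by now apply Rinv_0_lt_compat.
  apply cost_shift; trivial; lra. }
assert (hlow : forall c, ER_lt (Fin c) (G 0 x) -> exists M, 0 < M /\
  forall al, M < al -> ER_lt (Fin c) (ER_scal (/ al) (F (1 + al * x)))).
{ intros c hc.
  destruct (cost_lsc G hG 0 x (Rle_refl 0) hx c hc) as [d [hd h]].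
  assert (hd' : 0 < / d) by now apply Rinv_0_lt_compat.
  exists (/ d); split; trivial; intros al hal; rewrite hval by lra.
  assert (0 < / al) by (apply Rinv_0_lt_compat; lra).
  assert (/ al < d).
  { rewrite <- (Rinv_inv d); apply Rinv_lt_contravar; trivial.
    apply Rmult_lt_0_compat; lra. }
  apply h; try lra; apply Rabs_def1; lra. }
destruct (G 0 x) as [L|]; simpl.
- intros eps heps.
  destruct (hlow (L - eps)) as [M [hM h]]; [rewrite ER_lt_Fin; lra|].
  exists M; intros al hal; specialize (h al hal); specialize (hup al).
  rewrite ER_lt_Fin in h; destruct (ER_scal _ _) as [y|].
  + exists y; split; trivial; simpl in hup; apply Rabs_def1; lra.
  + simpl in hup; lra.
- intros K; destruct (hlow K) as [M [hM h]]; [now rewrite ER_lt_Fin|].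
  now exists M.
Qed.

(** This is the passage between functions of one variable, on which [Ta] acts, and costs: a cost is
    the perspective of its section at 1. *)
Lemma persp_cost F G x y :
  cost G -> (forall s, 0 <= s -> F s = G 1 s) -> 0 <= x -> 0 <= y ->
  persp F x y = G x y.
Proof.
intros hG hF hx hy; unfold persp; destruct (Rlt_dec 0 y) as [h|h].
- assert (0 <= x / y) by (apply Rle_mult_inv_pos; lra).
  rewrite hF, <- (cost_hom G hG) by lra.
  rewrite (cost_sym G hG x y) by trivial; f_equal; field; lra.
- replace y with 0 by lra; rewrite cost_sym by (trivial; lra).
  now apply recF_cost.
Qed.

(** * The infimal midpoint cost *)

(** The range is closed at 0, where [Htilde] takes theta > 0, so that the infimum can be
    attained. *)
Definition midcost (G : R -> R -> ER) (x y : R) : ER :=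
  ER_inf (fun v => exists t, 0 <= t /\ v = ER_add (G t x) (G t y)).

Lemma midcostP G x y : cost G -> 0 <= x -> 0 <= y ->
  ER_is_glb (fun v => exists t, 0 <= t /\ v = ER_add (G t x) (G t y)) (midcost G x y).
Proof.
intros hG hx hy; apply ER_infP; intros v [t [ht ->]].
apply ER_add_nonneg; now apply cost_nonneg.
Qed.

Lemma midcost_le G x y t : cost G -> 0 <= x -> 0 <= y -> 0 <= t ->
  ER_le (midcost G x y) (ER_add (G t x) (G t y)).
Proof. intros hG hx hy ht; apply midcostP; trivial; now exists t. Qed.

Lemma midcost_ge G x y e : cost G -> 0 <= x -> 0 <= y ->
  (forall t, 0 <= t -> ER_le e (ER_add (G t x) (G t y))) -> ER_le e (midcost G x y).
Proof.
intros hG hx hy h; apply (midcostP G x y hG hx hy); intros v [t [ht ->]]; auto.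
Qed.

(* Moving the midpoint down to an upper bound of x and y does not increase the cost, so
   the infimum is over a compact interval. *)
Lemma midcost_ge_bounded G x y b e : cost G -> 0 <= x <= b -> 0 <= y <= b ->
  (forall t, 0 <= t <= b -> ER_le e (ER_add (G t x) (G t y))) ->
  ER_le e (midcost G x y).
Proof.
intros hG hx hy h; apply midcost_ge; trivial; try lra; intros t ht.
destruct (Rle_dec t b); [apply h; lra|].
apply ER_le_trans with (1 := h b ltac:(lra)).
apply ER_add_le; apply cost_mono; trivial; lra.
Qed.

Lemma cost_sum_lsc G x y t c : cost G -> 0 <= x -> 0 <= y -> 0 <= t ->
  ER_lt (Fin c) (ER_add (G t x) (G t y)) ->
  exists d, 0 < d /\ forall t' x' y', 0 <= t' -> 0 <= x' -> 0 <= y' ->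
    Rabs (t' - t) < d -> Rabs (x' - x) < d -> Rabs (y' - y) < d ->
    ER_lt (Fin c) (ER_add (G t' x') (G t' y')).
Proof.
intros hG hx hy ht hc; apply ER_lt_add in hc.
destruct hc as [c1 [c2 [h1 [h2 hc]]]].
destruct (cost_lsc G hG t x ht hx _ h1) as [d1 [hd1 h1']].
destruct (cost_lsc G hG t y ht hy _ h2) as [d2 [hd2 h2']].
exists (Rmin d1 d2); split; [now apply Rmin_pos|].
pose proof (Rmin_l d1 d2); pose proof (Rmin_r d1 d2).
intros t' x' y' ht' hx' hy' at' ax ay; apply ER_lt_add.
exists c1, c2; split; [apply h1'; lra|split; [apply h2'; lra|trivial]].
Qed.

(** Near each midpoint [t] the lower bound persists for nearby endpoints; compactness in [t] makes
    the neighbourhood of the endpoints uniform. *)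
Lemma midcost_lsc G : cost G -> lsc2_ER (midcost G).
Proof.
intros hG x1 x2 hx1 hx2 c hc.
(* An infimum of values above [c'] is only known to be at least [c']; the margin keeps the final
   bound strict. *)
destruct (ER_lt_dense c _ hc) as [c' [hcc' hc']].
(* The extra 1 lets [b] bound all endpoints within distance 1 of [x1] and [x2]. *)
set (b := Rmax x1 x2 + 1).
assert (hb1 : x1 + 1 <= b) by (unfold b; pose proof (Rmax_l x1 x2); lra).
assert (hb2 : x2 + 1 <= b) by (unfold b; pose proof (Rmax_r x1 x2); lra).
destruct (interval_compact (fun A => exists d, 0 < d /\ forall t y1 y2, A t ->
  0 <= t -> 0 <= y1 -> 0 <= y2 -> Rabs (y1 - x1) < d -> Rabs (y2 - x2) < d ->
  ER_lt (Fin c') (ER_add (G t y1) (G t y2))) b) as [d [hd h]].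
- lra.
- intros A B hAB [d [hd h]]; exists d; split; auto.
- intros A B [d1 [hd1 h1]] [d2 [hd2 h2]].
  exists (Rmin d1 d2); split; [now apply Rmin_pos|].
  pose proof (Rmin_l d1 d2); pose proof (Rmin_r d1 d2).
  intros t y1 y2 [hA|hB] ht hy1 hy2 a1 a2; [apply h1|apply h2]; trivial; lra.
- intros t ht.
  destruct (cost_sum_lsc G x1 x2 t c' hG hx1 hx2 ht) as [d [hd h]].
  { apply ER_lt_le_trans with (1 := hc'); now apply midcost_le. }
  exists d; split; trivial; exists d; split; trivial.
  intros t' y1 y2 [_ at'] ht' hy1 hy2 a1 a2; now apply h.
- exists (Rmin d 1); split; [apply Rmin_pos; lra|].
  pose proof (Rmin_l d 1); pose proof (Rmin_r d 1).
  intros y1 y2 hy1 hy2 a1 a2.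
  apply ER_le_lt_Fin with (1 := hcc').
  assert (y1 <= b) by (apply Rabs_def2 in a1; lra).
  assert (y2 <= b) by (apply Rabs_def2 in a2; lra).
  apply midcost_ge_bounded with (b := b); trivial; try lra.
  intros t ht; apply h; lra.
Qed.

(** Midpoints follow their endpoints: [t] scales with (x, y), and t + t' serves the pair (x + x', y
    + y'). On the diagonal the point itself is a midpoint of cost 0. *)
Lemma midcost_cost G : cost G -> cost (midcost G).
Proof.
intros hG.
assert (hnn : forall x y, 0 <= x -> 0 <= y -> ER_le (Fin 0) (midcost G x y)).
{ intros x y hx hy; apply midcost_ge; trivial; intros t ht.
  apply ER_add_nonneg; now apply cost_nonneg. }
assert (hsym : forall x y, 0 <= x -> 0 <= y -> ER_le (midcost G x y) (midcost G y x)).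
{ intros x y hx hy; apply midcost_ge; trivial; intros t ht.
  rewrite ER_add_comm; now apply midcost_le. }
assert (hhom : forall t x y, 0 < t -> 0 <= x -> 0 <= y ->
  ER_le (midcost G (t * x) (t * y)) (ER_scal t (midcost G x y))).
{ intros t x y ht hx hy.
  assert (0 < / t) by now apply Rinv_0_lt_compat.
  assert (0 <= t * x) by (apply Rmult_le_pos; lra).
  assert (0 <= t * y) by (apply Rmult_le_pos; lra).
  enough (h : ER_le (ER_scal (/ t) (midcost G (t * x) (t * y))) (midcost G x y)).
  { apply ER_scal_le with (1 := ht) in h; rewrite ER_scal_scal in h.
    now rewrite Rinv_r, ER_scal_1 in h by lra. }
  apply midcost_ge; trivial; intros u hu.
  assert (0 <= t * u) by (apply Rmult_le_pos; lra).
  replace (ER_add (G u x) (G u y)) with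
    (ER_scal (/ t) (ER_add (G (t * u) (t * x)) (G (t * u) (t * y)))).
  - apply ER_scal_le; trivial; now apply midcost_le.
  - rewrite !cost_hom, <- ER_scal_add, ER_scal_scal, Rinv_l, ER_scal_1 by (trivial; lra).
    trivial. }
split; trivial.
- intros x y hx hy; apply ER_le_antisym; auto.
- now apply hom_of_le.
- intros x y x' y' hx hy hx' hy'.
  apply (ER_glb_add _ _ _ _ _ (midcostP G x y hG hx hy) (midcostP G x' y' hG hx' hy')).
  intros v w [t [ht ->]] [t' [ht' ->]].
  rewrite ER_add_swap.
  apply ER_le_trans with (ER_add (G (t + t') (x + x')) (G (t + t') (y + y'))).
  + apply midcost_le; trivial; lra.
  + apply ER_add_le; now apply cost_subadd.
- now apply midcost_lsc.
- intros x hx; apply ER_le_antisym; auto.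
  apply ER_le_trans with (1 := midcost_le G x x x hG hx hx hx).
  rewrite cost_diag by trivial; simpl; lra.
Qed.

Lemma midcost_mono G G' x y :
  cost G -> cost G' -> (forall x y, 0 <= x -> 0 <= y -> ER_le (G x y) (G' x y)) ->
  0 <= x -> 0 <= y -> ER_le (midcost G x y) (midcost G' x y).
Proof.
intros hG hG' hle hx hy; apply midcost_ge; trivial; intros t ht.
apply ER_le_trans with (1 := midcost_le G x y t hG hx hy ht).
apply ER_add_le; auto.
Qed.

(** Otherwise each [t] gives a value above [v], with a gap that is locally uniform by lower
    semicontinuity, hence uniform by compactness; the infimum would exceed [v]. *)
Lemma midcost_attained G x y v : cost G -> 0 <= x -> 0 <= y ->
  midcost G x y = Fin v -> exists t, 0 <= t /\ ER_add (G t x) (G t y) = Fin v.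
Proof.
intros hG hx hy hv; apply NNPP; intros hn.
set (b := Rmax x y).
assert (hb1 : x <= b) by apply Rmax_l.
assert (hb2 : y <= b) by apply Rmax_r.
destruct (interval_compact (fun A => exists c, v < c /\ forall t, A t -> 0 <= t ->
  ER_le (Fin c) (ER_add (G t x) (G t y))) b) as [c [hc h]].
- lra.
- intros A B hAB [c [hc h]]; exists c; auto.
- intros A B [c1 [hc1 h1]] [c2 [hc2 h2]].
  exists (Rmin c1 c2); split; [now apply Rmin_glb_lt|].
  intros t [ht|ht] ht0.
  + apply ER_le_trans with (2 := h1 t ht ht0); apply Rmin_l.
  + apply ER_le_trans with (2 := h2 t ht ht0); apply Rmin_r.
- intros t ht.
  assert (hlt : ER_lt (Fin v) (ER_add (G t x) (G t y))).
  { split; [rewrite <- hv; now apply midcost_le|].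
    intros e; apply hn; now exists t. }
  apply ER_lt_dense in hlt; destruct hlt as [c [hc hlt]].
  destruct (cost_sum_lsc G x y t c hG hx hy ht hlt) as [d [hd h]].
  exists d; split; trivial; exists c; split; trivial.
  intros t' [_ at'] ht'; apply h; trivial; unfold Rminus; rewrite Rplus_opp_r, Rabs_R0; lra.
- assert (hle : ER_le (Fin c) (midcost G x y)).
  { apply midcost_ge_bounded with (b := b); trivial; try lra.
    intros t ht; apply h; lra. }
  rewrite hv in hle; simpl in hle; lra.
Qed.

(* Taking t > 0 and the lower semicontinuous envelope in HF change nothing at (1, s). *)
Lemma HF_midcost F G s : cost G -> (forall r, 0 <= r -> F r = G 1 r) -> 0 <= s ->
  HF F 1 s = midcost G 1 s.
Proof.
intros hG hF hs.
assert (hpersp : forall x y, 0 <= x -> 0 <= y -> persp F x y = G x y).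
{ intros; now apply persp_cost. }
assert (hH : forall x y, 0 <= x -> 0 <= y -> ER_is_glb (fun v => exists t, 0 < t /\
   v = ER_add (persp F t x) (persp F t y)) (Htilde F x y)).
{ intros x y hx hy; apply ER_infP; intros v [t [ht ->]].
  rewrite !hpersp by lra; apply ER_add_nonneg; apply cost_nonneg; trivial; lra. }
assert (hpos : forall t, 0 < t -> ER_le (Htilde F 1 s) (ER_add (G t 1) (G t s))).
{ intros t ht; rewrite <- !hpersp by lra; apply hH; trivial; try lra; now exists t. }
assert (hle : ER_le (Htilde F 1 s) (midcost G 1 s)).
{ apply midcost_ge; trivial; try lra; intros t ht.
  (* Only [t] = 0 is missing in [Htilde]. The larger endpoint is at least as good a midpoint: it
     costs [G 1 s], which is at most one of the two terms at 0. *)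
  destruct (Req_dec t 0) as [->|ht0]; [|apply hpos; lra].
  destruct (Rle_dec s 1) as [hs1|hs1].
  - apply ER_le_trans with (1 := hpos 1 Rlt_0_1).
    rewrite cost_diag, ER_add_0_l, cost_sym by (trivial; lra).
    apply ER_le_trans with (G 0 1); [apply cost_le_axis; trivial; lra|].
    apply ER_le_add_l, cost_nonneg; trivial; lra.
  - apply ER_le_trans with (1 := hpos s ltac:(lra)).
    rewrite (cost_diag G hG s), ER_add_0_r, cost_sym by (trivial; lra).
    apply ER_le_trans with (G 0 s); [apply cost_le_axis; trivial; lra|].
    apply ER_le_add_r, cost_nonneg; trivial; lra. }
apply ER_sup_eq; split.
- intros v [g [_ [hg ->]]].
  apply ER_le_trans with (2 := hle); apply hg; trivial; lra.
(* [midcost G] is itself a lower semicontinuous minorant of [Htilde F], so it competes in the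
   supremum. *)
- intros m hm; apply hm; exists (midcost G); split; [now apply midcost_lsc|].
  split; trivial; intros x y hx hy; apply hH; trivial.
  intros v [t [ht ->]]; rewrite !hpersp by lra; apply midcost_le; trivial; lra.
Qed.

(** * Powers *)

Lemma rpow_0 a : rpow 0 a = 0.
Proof. unfold rpow; destruct (Rle_dec 0 0); lra. Qed.

Lemma rpow_Rpower x a : 0 < x -> rpow x a = Rpower x a.
Proof. intros hx; unfold rpow; destruct (Rle_dec x 0); trivial; lra. Qed.

Lemma rpow_pos x a : 0 < x -> 0 < rpow x a.
Proof. intros hx; rewrite rpow_Rpower by trivial; apply exp_pos. Qed.

Lemma rpow_nonneg x a : 0 <= rpow x a.
Proof.
destruct (Rlt_dec 0 x) as [h|h]; [now apply Rlt_le, rpow_pos|].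
unfold rpow; destruct (Rle_dec x 0); lra.
Qed.

Lemma rpow_1 a : rpow 1 a = 1.
Proof. rewrite rpow_Rpower by lra; unfold Rpower; now rewrite ln_1, Rmult_0_r, exp_0. Qed.

Lemma rpow_mult x y a : 0 <= x -> 0 <= y -> rpow (x * y) a = rpow x a * rpow y a.
Proof.
intros [hx|<-] [hy|<-]; rewrite ?Rmult_0_l, ?Rmult_0_r, ?rpow_0; try lra.
rewrite !rpow_Rpower by (trivial; now apply Rmult_lt_0_compat).
now rewrite Rpower_mult_distr.
Qed.

Lemma rpow_lt x y a : 0 < a -> 0 <= x < y -> rpow x a < rpow y a.
Proof.
intros ha [[hx|<-] hy].
- rewrite !rpow_Rpower by lra; apply Rlt_Rpower_l; lra.
- rewrite rpow_0; apply rpow_pos; lra.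
Qed.

Lemma rpow_le x y a : 0 < a -> 0 <= x <= y -> rpow x a <= rpow y a.
Proof.
intros ha [hx [hy|<-]]; [|apply Rle_refl].
apply Rlt_le, rpow_lt; lra.
Qed.

Lemma rpow_lt_1 x a : 0 < a -> 0 <= x < 1 -> rpow x a < 1.
Proof. intros ha hx; rewrite <- (rpow_1 a); now apply rpow_lt. Qed.

Lemma rpow_le_inv x y a : 0 < a -> 0 <= x -> 0 <= y -> rpow x a <= rpow y a -> x <= y.
Proof.
intros ha hx hy h; apply Rnot_lt_le; intros hlt.
enough (rpow y a < rpow x a) by lra; apply rpow_lt; lra.
Qed.

Lemma rpow_inj x y a : 0 < a -> 0 <= x -> 0 <= y -> rpow x a = rpow y a -> x = y.
Proof. intros ha hx hy h; apply Rle_antisym; apply rpow_le_inv with a; lra. Qed.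

Lemma rpow_rpow x a b : rpow (rpow x a) b = rpow x (a * b).
Proof.
unfold rpow at 2 3; destruct (Rle_dec x 0) as [h|h]; [apply rpow_0|].
rewrite rpow_Rpower by apply exp_pos; apply Rpower_mult.
Qed.

Lemma rpow_invK x a : 0 < a -> 0 <= x -> rpow (rpow x a) (1 / a) = x.
Proof.
intros ha hx; rewrite rpow_rpow; replace (a * (1 / a)) with 1 by (field; lra).
destruct hx as [hx|<-]; [|apply rpow_0].
rewrite rpow_Rpower by trivial; now apply Rpower_1.
Qed.

Lemma rpow_Kinv x a : 0 < a -> 0 <= x -> rpow (rpow x (1 / a)) a = x.
Proof.
intros ha hx; rewrite rpow_rpow, Rmult_comm, <- rpow_rpow; now apply rpow_invK.
Qed.

(** Strict concavity: the graph of the power lies below its tangent at 1. *)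
Lemma rpow_tangent_lt a x : 0 < a < 1 -> 0 <= x -> x <> 1 -> rpow x a < a * x + (1 - a).
Proof.
intros ha [hx|<-] hx1; [|rewrite rpow_0; lra].
rewrite rpow_Rpower by trivial; unfold Rpower.
set (y := ln x); assert (ex : x = exp y) by (unfold y; now rewrite exp_ln).
assert (hy : y <> 0) by (intros e; apply hx1; now rewrite ex, e, exp_0).
rewrite ex; clearbody y.
(* With weights [a] and [1 - a] the linear terms of [h1] and [h2] cancel, which gives [h3];
   multiplying by exp (a y) yields the claim for x = exp y. *)
assert (h1 : 1 + (1 - a) * y < exp ((1 - a) * y)).
{ apply exp_ineq1; intros h; apply Rmult_integral in h; lra. }
assert (h2 : 1 + - (a * y) < exp (- (a * y))).
{ apply exp_ineq1; intros h; apply hy; apply Rmult_eq_reg_l with a; lra. }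
assert (e1 : exp y = exp (a * y) * exp ((1 - a) * y)) by (rewrite <- exp_plus; f_equal; ring).
assert (e2 : 1 = exp (a * y) * exp (- (a * y))) by (rewrite <- exp_plus, Rplus_opp_r, exp_0; ring).
pose proof (exp_pos (a * y)) as hE.
assert (h3 : 1 < a * exp ((1 - a) * y) + (1 - a) * exp (- (a * y))) by nra.
apply Rmult_lt_compat_l with (1 := hE) in h3; rewrite e1; nra.
Qed.

Lemma rpow_tangent a x : 0 < a < 1 -> 0 <= x -> rpow x a <= a * x + (1 - a).
Proof.
intros ha hx; destruct (Req_dec x 1) as [->|h].
- rewrite rpow_1; lra.
- now apply Rlt_le, rpow_tangent_lt.
Qed.

(** The factor in [Ta]; it is the constant for which [rpow_add_le] is an equality when u = v. *)
Definition jensen_const (a : R) : R := Rpower 2 (1 / a - 1).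

Lemma jensen_const_pos a : 0 < jensen_const a.
Proof. apply exp_pos. Qed.

Lemma rpow_jensen_const a m : 0 < a -> 0 <= m ->
  rpow (jensen_const a * (2 * m)) a = 2 * rpow m a.
Proof.
intros ha hm.
assert (hp : 0 < jensen_const a) by apply exp_pos.
rewrite !rpow_mult by lra.
rewrite <- Rmult_assoc; f_equal.
unfold jensen_const; rewrite !rpow_Rpower by (apply exp_pos || lra).
rewrite Rpower_mult, <- Rpower_plus.
replace ((1 / a - 1) * a + a) with 1 by (field; lra); apply Rpower_1; lra.
Qed.

(** Divide by the mean [m] and add the tangent inequalities at u / m and v / m, whose sum is 2. *)
Lemma rpow_add_le a u v : 0 < a < 1 -> 0 <= u -> 0 <= v ->
  rpow u a + rpow v a <= rpow (jensen_const a * (u + v)) a.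
Proof.
intros ha hu hv.
destruct (Req_dec (u + v) 0) as [h|h].
{ replace u with 0 by lra; replace v with 0 by lra.
  rewrite rpow_0; pose proof (rpow_nonneg (jensen_const a * (0 + 0)) a); lra. }
set (m := (u + v) / 2); assert (hm : 0 < m) by (unfold m; lra).
replace (u + v) with (2 * m) by (unfold m; lra).
rewrite rpow_jensen_const by lra.
assert (hu' : 0 <= u / m) by (apply Rle_mult_inv_pos; lra).
assert (hv' : 0 <= v / m) by (apply Rle_mult_inv_pos; lra).
replace u with (m * (u / m)) by (field; lra); replace v with (m * (v / m)) by (field; lra).
rewrite !rpow_mult by lra.
assert (e : u / m + v / m = 2) by (unfold m; field; lra).
pose proof (rpow_tangent a (u / m) ha hu'); pose proof (rpow_tangent a (v / m) ha hv').
rewrite <- Rmult_plus_distr_l, (Rmult_comm 2).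
apply (f_equal (Rmult a)) in e; rewrite Rmult_plus_distr_l in e.
apply Rmult_le_compat_l; [apply rpow_nonneg|lra].
Qed.

(** If u and v differ, then u / m is not 1 and the tangent inequality is strict there. *)
Lemma rpow_add_eq a u v : 0 < a < 1 -> 0 <= u -> 0 <= v ->
  rpow (jensen_const a * (u + v)) a <= rpow u a + rpow v a -> u = v.
Proof.
intros ha hu hv hle; apply NNPP; intros hne.
set (m := (u + v) / 2); assert (hm : 0 < m) by (unfold m; lra).
revert hle; replace (u + v) with (2 * m) by (unfold m; lra).
rewrite rpow_jensen_const by lra; apply Rlt_not_le.
assert (hu' : 0 <= u / m) by (apply Rle_mult_inv_pos; lra).
assert (hv' : 0 <= v / m) by (apply Rle_mult_inv_pos; lra).
assert (hu1 : u / m <> 1).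
{ intros h; apply hne; assert (u = m) by (apply Rmult_eq_reg_r with (/ m);
   [rewrite Rinv_r by lra; exact h|apply Rinv_neq_0_compat; lra]); unfold m in *; lra. }
replace u with (m * (u / m)) by (field; lra); replace v with (m * (v / m)) by (field; lra).
rewrite !rpow_mult by lra.
assert (e : u / m + v / m = 2) by (unfold m; field; lra).
pose proof (rpow_tangent_lt a (u / m) ha hu' hu1); pose proof (rpow_tangent a (v / m) ha hv').
rewrite <- Rmult_plus_distr_l, (Rmult_comm 2).
apply (f_equal (Rmult a)) in e; rewrite Rmult_plus_distr_l in e.
apply Rmult_lt_compat_l; [now apply rpow_pos|lra].
Qed.

(** * The perspective of an entropy is a cost *)

Lemma persp_pos F x y : 0 < y -> persp F x y = ER_scal y (F (x / y)).
Proof. intros hy; unfold persp; destruct (Rlt_dec 0 y); trivial; lra. Qed.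

Lemma persp_1_r F x : persp F x 1 = F x.
Proof. rewrite persp_pos by lra; rewrite ER_scal_1; f_equal; field. Qed.

Lemma persp_0_0 F : F 1 = Fin 0 -> persp F 0 0 = Fin 0.
Proof.
intros h1; unfold persp; destruct (Rlt_dec 0 0) as [h|_]; [lra|].
apply Lim_infty_eq; intros eps heps; exists 0; intros al _; exists 0.
rewrite Rmult_0_r, Rplus_0_r, h1; simpl; split; [f_equal; ring|].
rewrite Rminus_diag, Rabs_R0; lra.
Qed.

Lemma toR_ER_pow e a : toR (ER_pow e a) = rpow (toR e) a.
Proof. destruct e; simpl; [trivial|now rewrite rpow_0]. Qed.

Lemma ER_metric_finite G a x y :
  ER_metric (fun x y => ER_pow (G x y) a) -> 0 <= x -> 0 <= y -> G x y = Fin (toR (G x y)).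
Proof.
intros [h _] hx hy; specialize (h x y hx hy); now destruct (G x y).
Qed.

(** Symmetry of the power passes to its base only for nonnegative bases, and on the axis y = 0 the
    sign of the recession value has to be established first. *)
Lemma persp_sym F a x y : 0 < a -> Gamma0 F ->
  ER_metric (fun x y => ER_pow (persp F x y) a) -> 0 <= x -> 0 <= y ->
  persp F x y = persp F y x.
Proof.
intros ha [hnn [_ [_ h1]]] hmet.
assert (hpos : forall x y, 0 <= x -> 0 < y -> 0 <= toR (persp F x y)).
{ intros u v hu hv; rewrite persp_pos by trivial.
  assert (0 <= u / v) by (apply Rle_mult_inv_pos; lra).
  assert (h : ER_le (Fin 0) (ER_scal v (F (u / v)))) by (apply ER_scal_nonneg; auto).
  destruct (ER_scal v (F (u / v))); simpl in *; lra. }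
assert (hpos' : forall x y, 0 <= x -> 0 <= y -> 0 <= toR (persp F x y)).
{ intros u v hu [hv|<-]; auto.
  destruct hu as [hu|<-]; [|rewrite persp_0_0; simpl; trivial; lra].
  (* [rpow] sends negative numbers to 0, so a negative value at (u, 0) would put u > 0 at distance 0
     from 0. *)
  destruct hmet as [_ [_ [hsep _]]]; specialize (hsep u 0); rewrite toR_ER_pow in hsep.
  apply Rnot_lt_le; intros hn; enough (u = 0) by lra.
  apply hsep; try lra; unfold rpow; destruct (Rle_dec _ 0); trivial; lra. }
intros hx hy.
rewrite (ER_metric_finite (persp F) a x y), (ER_metric_finite (persp F) a y x) by trivial.
f_equal; apply rpow_inj with a; auto.
destruct hmet as [_ [_ [_ [hs _]]]]; rewrite <- !toR_ER_pow; auto.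
Qed.

Lemma persp_lsc_pos F x y c : Gamma0 F -> 0 <= x -> 0 < y -> ER_lt (Fin c) (persp F x y) ->
  exists d, 0 < d /\ forall x' y', 0 <= x' -> 0 <= y' -> Rabs (x' - x) < d ->
    Rabs (y' - y) < d -> 0 < y' /\ ER_lt (Fin c) (persp F x' y').
Proof.
intros [hnn [_ [hlsc _]]] hx hy hc.
assert (hxy : 0 <= x / y) by (apply Rle_mult_inv_pos; lra).
rewrite persp_pos in hc by trivial.
destruct (Rlt_dec c 0) as [hc0|hc0].
{ exists y; split; trivial; intros x' y' hx' hy' _ ay.
  assert (0 < y') by (apply Rabs_def2 in ay; lra); split; trivial.
  assert (0 <= x' / y') by (apply Rle_mult_inv_pos; lra).
  rewrite persp_pos by trivial.
  apply ER_le_lt_Fin with (1 := hc0); apply ER_scal_nonneg; auto. }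
apply ER_lt_scal in hc; trivial.
assert (hcy : 0 <= c / y) by (apply Rle_mult_inv_pos; lra).
(* Two conditions suffice for the bound at (x', y'): y' > c / c1, and x' / y' within [d1] of x /
   y. *)
destruct (ER_lt_dense _ _ hc) as [c1 [hc1 hlt]].
assert (hc1' : c < y * c1).
{ apply Rmult_lt_compat_l with (1 := hy) in hc1.
  replace (y * (c / y)) with c in hc1 by (field; lra); trivial. }
destruct (hlsc _ hxy c1 hlt) as [d1 [hd1 hl]].
assert (hq : c / c1 < y).
{ apply Rmult_lt_reg_r with c1; [lra|]; field_simplify; lra. }
(* Chosen so that d2 (x + y) / (y' y) < d1 whenever y' > y / 2; the left side bounds the change of
   the quotient. *)
set (d2 := d1 * (y * y) / (2 * (x + y))).
assert (hd2 : 0 < d2).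
{ apply Rdiv_lt_0_compat; [|lra]; repeat apply Rmult_lt_0_compat; trivial. }
set (d := Rmin (y / 2) (Rmin (y - c / c1) d2)).
assert (hd : 0 < d) by (repeat apply Rmin_pos; lra).
assert (k1 : d <= y / 2) by apply Rmin_l.
assert (k2 : d <= y - c / c1).
{ apply Rle_trans with (1 := Rmin_r _ _); apply Rmin_l. }
assert (k3 : d <= d2).
{ apply Rle_trans with (1 := Rmin_r _ _); apply Rmin_r. }
exists d; split; trivial; intros x' y' hx' hy' ax ay.
assert (hy'2 : y / 2 < y') by (apply Rabs_def2 in ay; lra).
assert (hy'c : c / c1 < y') by (apply Rabs_def2 in ay; lra).
split; [lra|].
rewrite persp_pos by lra; apply ER_lt_scal; [lra|].
apply ER_lt_le_trans with (Fin c1).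
- rewrite ER_lt_Fin; apply Rmult_lt_reg_r with (y' / c1); [apply Rdiv_lt_0_compat; lra|].
  field_simplify; lra.
- apply hl; [apply Rle_mult_inv_pos; lra|].
  replace (x' / y' - x / y) with (((x' - x) * y + x * (y - y')) / (y' * y)) by (field; lra).
  assert (hyy : 0 < y' * y) by (apply Rmult_lt_0_compat; lra).
  unfold Rdiv; rewrite Rabs_mult, (Rabs_pos_eq (/ _)) by (apply Rlt_le, Rinv_0_lt_compat; lra).
  apply Rmult_lt_reg_r with (1 := hyy); rewrite Rmult_assoc, Rinv_l, Rmult_1_r by lra.
  apply Rle_lt_trans with (1 := Rabs_triang _ _).
  rewrite !Rabs_mult, (Rabs_pos_eq x), (Rabs_pos_eq y), (Rabs_minus_sym y) by lra.
  assert (e : d2 * (x + y) = d1 * (y * y / 2)) by (unfold d2; field; lra).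
  apply Rle_lt_trans with (d2 * (x + y)).
  + rewrite Rmult_plus_distr_l, (Rmult_comm x), Rplus_comm.
    apply Rplus_le_compat; apply Rmult_le_compat_r; lra.
  + rewrite e; apply Rmult_lt_compat_l; trivial; nra.
Qed.

(** Convexity of [F] at x / y and x' / y' with weights proportional to y and y'. *)
Lemma persp_subadd_pos F x y x' y' : Gamma0 F -> 0 <= x -> 0 <= x' -> 0 < y -> 0 < y' ->
  ER_le (persp F (x + x') (y + y')) (ER_add (persp F x y) (persp F x' y')).
Proof.
intros [_ [hconv _]] hx hx' hy hy'.
rewrite !persp_pos by lra.
set (l := y / (y + y')).
assert (hl : 0 < l < 1).
{ unfold l; split; [apply Rdiv_lt_0_compat; lra|].
  apply Rmult_lt_reg_r with (y + y'); [lra|]; field_simplify; lra. }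
assert (h : ER_le (F (l * (x / y) + (1 - l) * (x' / y')))
  (ER_add (ER_scal l (F (x / y))) (ER_scal (1 - l) (F (x' / y'))))).
{ apply hconv; trivial; apply Rle_mult_inv_pos; lra. }
replace (l * (x / y) + (1 - l) * (x' / y')) with ((x + x') / (y + y')) in h
  by (unfold l; field; lra).
apply ER_scal_le with (t := y + y') in h; [|lra].
rewrite ER_scal_add, !ER_scal_scal in h.
replace ((y + y') * l) with y in h by (unfold l; field; lra).
replace ((y + y') * (1 - l)) with y' in h by (unfold l; field; lra).
trivial.
Qed.

(** As F(1) = 0, convexity on [0, 1] gives F(s) <= (1 - s) F(0). *)
Lemma persp_le_axis F x y : Gamma0 F -> 0 <= x <= y ->
  ER_le (persp F x y) (persp F 0 y).
Proof.
intros [hnn [hconv [_ h1]]] hxy.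
destruct (Req_dec x 0) as [->|hx]; [apply ER_le_refl|].
rewrite !persp_pos by lra; apply ER_scal_le; [lra|].
rewrite Rdiv_0_l.
destruct (Req_dec x y) as [->|hne].
{ rewrite Rdiv_diag, h1 by lra; apply hnn; lra. }
set (l := 1 - x / y).
assert (hl : 0 < l < 1).
{ assert (0 < x / y) by (apply Rdiv_lt_0_compat; lra).
  assert (x / y < 1) by (apply Rmult_lt_reg_r with y; [lra|]; field_simplify; lra).
  unfold l; lra. }
pose proof (hconv 0 1 l (Rle_refl 0) Rle_0_1 hl) as h.
replace (l * 0 + (1 - l) * 1) with (x / y) in h by (unfold l; ring).
apply ER_le_trans with (1 := h); rewrite h1; simpl; rewrite Rmult_0_r, ER_add_0_r.
apply ER_scal_le_self; [lra|]; apply hnn; lra.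
Qed.

(** Symmetry moves the axis y = 0 to x = 0, where the formula y F(x / y) applies; only the origin
    and sums across the two axes need separate arguments. *)
Lemma persp_is_cost F a : 0 < a -> Gamma0 F ->
  ER_metric (fun x y => ER_pow (persp F x y) a) -> cost (persp F).
Proof.
intros ha hF hmet.
assert (hsym : forall x y, 0 <= x -> 0 <= y -> persp F x y = persp F y x).
{ intros x y; now apply persp_sym with a. }
assert (h00 : persp F 0 0 = Fin 0) by (apply persp_0_0, hF).
assert (hnn : forall x y, 0 <= x -> 0 < y -> ER_le (Fin 0) (persp F x y)).
{ intros x y hx hy; rewrite persp_pos by trivial; apply ER_scal_nonneg; trivial.
  apply hF, Rle_mult_inv_pos; lra. }
assert (hnn' : forall x y, 0 <= x -> 0 <= y -> ER_le (Fin 0) (persp F x y)).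
{ intros x y [hx|<-] [hy|<-]; try (apply hnn; lra).
  - rewrite hsym by lra; apply hnn; lra.
  - rewrite h00; apply ER_le_refl. }
assert (hhom : forall t x y, 0 < t -> 0 <= x -> 0 < y ->
  persp F (t * x) (t * y) = ER_scal t (persp F x y)).
{ intros t x y ht hx hy; assert (0 < t * y) by now apply Rmult_lt_0_compat.
  rewrite !persp_pos, ER_scal_scal by trivial; do 2 f_equal; field; lra. }
(* For (x, 0) and (0, y) no swap makes both second coordinates positive, so [persp_subadd_pos] does
   not cover this pair. *)
assert (hcross : forall x y, 0 <= x -> 0 <= y ->
  ER_le (persp F x y) (ER_add (persp F x 0) (persp F 0 y))).
{ intros x y hx hy; destruct (Rle_dec x y) as [h|h].
  - apply ER_le_trans with (persp F 0 y); [now apply persp_le_axis|].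
    apply ER_le_add_r, hnn'; lra.
  - apply ER_le_trans with (persp F x 0); [|apply ER_le_add_l, hnn'; lra].
    rewrite hsym, (hsym x 0) by lra; apply persp_le_axis; trivial; lra. }
split; trivial.
- intros t x y ht hx [hy|<-]; [now apply hhom|].
  destruct hx as [hx|<-].
  + rewrite hsym, (hsym x 0), <- hhom by (try apply Rmult_le_pos; lra); trivial.
  + rewrite Rmult_0_r, h00; simpl; now rewrite Rmult_0_r.
- intros x y x' y' hx hy hx' hy'.
  destruct (Req_dec y 0) as [->|hy0]; [destruct (Req_dec x 0) as [->|hx0]|].
  + rewrite h00, ER_add_0_l, !Rplus_0_l; apply ER_le_refl.
  + destruct (Req_dec x' 0) as [->|hx'0].
    * rewrite Rplus_0_r, Rplus_0_l; now apply hcross.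
    * rewrite (hsym (x + x')), (hsym x), (hsym x') by lra.
      apply persp_subadd_pos; trivial; lra.
  + destruct (Req_dec y' 0) as [->|hy'0]; [|apply persp_subadd_pos; trivial; lra].
    destruct (Req_dec x' 0) as [->|hx'0].
    * rewrite h00, ER_add_0_r, !Rplus_0_r; apply ER_le_refl.
    * destruct (Req_dec x 0) as [->|hx0].
      -- rewrite Rplus_0_r, Rplus_0_l, ER_add_comm; now apply hcross.
      -- rewrite (hsym (x + x')), (hsym x), (hsym x') by lra.
         apply persp_subadd_pos; trivial; lra.
- intros x y hx hy c hc.
  destruct hy as [hy|<-].
  + destruct (persp_lsc_pos F x y c hF hx hy hc) as [d [hd h]].
    exists d; split; trivial; intros; now apply h.
  + destruct hx as [hx|<-].
    * rewrite hsym in hc by lra.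
      destruct (persp_lsc_pos F 0 x c hF (Rle_refl 0) hx hc) as [d [hd h]].
      exists d; split; trivial; intros; rewrite hsym by trivial; now apply h.
    * rewrite h00, ER_lt_Fin in hc.
      exists 1; split; [lra|]; intros y1 y2 h1 h2 _ _.
      apply ER_le_lt_Fin with (1 := hc); now apply hnn'.
- intros x [hx|<-]; trivial.
  rewrite persp_pos, Rdiv_diag by lra.
  destruct hF as [_ [_ [_ ->]]]; simpl; now rewrite Rmult_0_r.
Qed.

(** * The iteration *)

Definition midstep (a : R) (G : R -> R -> ER) (x y : R) : ER :=
  ER_scal (jensen_const a) (midcost G x y).

Lemma midstep_cost a G : cost G -> cost (midstep a G).
Proof. intros hG; apply cost_scal; [apply jensen_const_pos|now apply midcost_cost]. Qed.

Lemma Ta_midstep a F G s : cost G -> (forall r, 0 <= r -> F r = G 1 r) -> 0 <= s ->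
  Ta a F s = midstep a G 1 s.
Proof.
intros hG hF hs; unfold Ta, midstep, jensen_const; now rewrite (HF_midcost F G).
Qed.

Lemma midstep_mono a G G' x y : cost G -> cost G' ->
  (forall x y, 0 <= x -> 0 <= y -> ER_le (G x y) (G' x y)) ->
  0 <= x -> 0 <= y -> ER_le (midstep a G x y) (midstep a G' x y).
Proof.
intros hG hG' hle hx hy; apply ER_scal_le; [apply jensen_const_pos|].
now apply midcost_mono.
Qed.

(* Triangle inequality for G^a combined with concavity of the power a. *)
Lemma le_midstep a G x y : 0 < a < 1 -> cost G ->
  ER_metric (fun x y => ER_pow (G x y) a) -> 0 <= x -> 0 <= y ->
  ER_le (G x y) (midstep a G x y).
Proof.
intros ha hG hmet hx hy.
pose proof (jensen_const_pos a) as hk.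
enough (h : ER_le (ER_scal (/ jensen_const a) (G x y)) (midcost G x y)).
{ apply ER_scal_le with (1 := hk) in h; rewrite ER_scal_scal in h.
  now rewrite Rinv_r, ER_scal_1 in h by lra. }
apply midcost_ge; trivial; intros t ht.
assert (hfin : forall x y, 0 <= x -> 0 <= y -> G x y = Fin (toR (G x y))).
{ intros u v; now apply ER_metric_finite with a. }
assert (hpos : forall x y, 0 <= x -> 0 <= y -> 0 <= toR (G x y)).
{ intros u v hu hv; pose proof (cost_nonneg G hG u v hu hv) as h.
  rewrite hfin in h; trivial. }
assert (htri : rpow (toR (G x y)) a <= rpow (toR (G t x)) a + rpow (toR (G t y)) a).
{ rewrite <- !toR_ER_pow; rewrite (cost_sym G hG t x) by trivial; now apply hmet. }
pose proof (hpos t x ht hx) as h1; pose proof (hpos t y ht hy) as h2.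
pose proof (hpos x y hx hy) as h3.
rewrite (hfin x y), (hfin t x), (hfin t y) by trivial; simpl.
apply Rmult_le_reg_l with (1 := hk); rewrite <- Rmult_assoc, Rinv_r, Rmult_1_l by lra.
apply rpow_le_inv with a; try lra.
- apply Rmult_le_pos; lra.
- apply Rle_trans with (1 := htri); now apply rpow_add_le.
Qed.

(** * Suprema of sequences of costs *)

Definition cost_sup (G : nat -> R -> R -> ER) (x y : R) : ER :=
  ER_sup (fun v => exists n, v = G n x y).

Lemma cost_supP G x y : ER_is_lub (fun v => exists n, v = G n x y) (cost_sup G x y).
Proof. apply ER_supP; exists (G 0%nat x y); now exists 0%nat. Qed.

Lemma cost_sup_ub G n x y : ER_le (G n x y) (cost_sup G x y).
Proof. apply cost_supP; now exists n. Qed.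

Lemma cost_sup_least G x y m : (forall n, ER_le (G n x y) m) -> ER_le (cost_sup G x y) m.
Proof. intros h; apply cost_supP; intros v [n ->]; auto. Qed.

Lemma lt_cost_sup G c x y : ER_lt (Fin c) (cost_sup G x y) ->
  exists n, ER_lt (Fin c) (G n x y).
Proof.
intros h; destruct (ER_lt_lub _ _ _ (cost_supP G x y) h) as [v [[n ->] hv]]; now exists n.
Qed.

Lemma cost_sup_cost G : (forall n, cost (G n)) -> cost (cost_sup G).
Proof.
intros hG.
assert (hhom : forall t x y, 0 < t -> 0 <= x -> 0 <= y ->
  ER_le (cost_sup G (t * x) (t * y)) (ER_scal t (cost_sup G x y))).
{ intros t x y ht hx hy; apply cost_sup_least; intros n.
  rewrite (cost_hom _ (hG n)) by trivial; apply ER_scal_le; trivial; apply cost_sup_ub. }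
split.
- intros x y hx hy; apply ER_le_trans with (2 := cost_sup_ub G 0 x y).
  now apply (cost_nonneg _ (hG 0%nat)).
- intros x y hx hy; apply ER_le_antisym; apply cost_sup_least; intros n;
    rewrite (cost_sym _ (hG n)) by trivial; apply cost_sup_ub.
- now apply hom_of_le.
- intros x y x' y' hx hy hx' hy'; apply cost_sup_least; intros n.
  apply ER_le_trans with (ER_add (G n x y) (G n x' y')).
  + now apply (cost_subadd _ (hG n)).
  + apply ER_add_le; apply cost_sup_ub.
- intros x y hx hy c hc; apply lt_cost_sup in hc; destruct hc as [n hn].
  destruct (cost_lsc _ (hG n) x y hx hy c hn) as [d [hd h]].
  exists d; split; trivial; intros y1 y2 h1 h2 a1 a2.
  apply ER_lt_le_trans with (2 := cost_sup_ub G n y1 y2); now apply h.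
- intros x hx; apply ER_le_antisym.
  + apply cost_sup_least; intros n; rewrite (cost_diag _ (hG n)) by trivial; apply ER_le_refl.
  + rewrite <- (cost_diag _ (hG 0%nat) x hx); apply cost_sup_ub.
Qed.

(** Exchange of the infimum over [t] with the supremum over [n]: each [t] has an index whose bound
    holds near [t], and by compactness and monotonicity one index serves the whole interval. *)
Lemma midcost_sup_lt G c x y :
  (forall n, cost (G n)) ->
  (forall n x y, 0 <= x -> 0 <= y -> ER_le (G n x y) (G (S n) x y)) ->
  0 <= x -> 0 <= y -> ER_lt (Fin c) (midcost (cost_sup G) x y) ->
  exists n, ER_le (Fin c) (midcost (G n) x y).
Proof.
intros hG hinc hx hy hc.
pose proof (cost_sup_cost G hG) as hS.
assert (hmono : forall n m, (n <= m)%nat -> forall x y, 0 <= x -> 0 <= y ->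
  ER_le (G n x y) (G m x y)).
{ intros n m hnm u v hu hv; induction hnm; [apply ER_le_refl|].
  apply ER_le_trans with (1 := IHhnm); auto. }
set (b := Rmax x y).
assert (hb1 : x <= b) by apply Rmax_l.
assert (hb2 : y <= b) by apply Rmax_r.
destruct (interval_compact (fun A => exists n, forall t, A t -> 0 <= t ->
  ER_le (Fin c) (ER_add (G n t x) (G n t y))) b) as [n h].
- lra.
- intros A B hAB [n h]; exists n; auto.
- intros A B [n1 h1] [n2 h2]; exists (max n1 n2); intros t [ht|ht] ht0.
  + apply ER_le_trans with (1 := h1 t ht ht0); apply ER_add_le; apply hmono; trivial; lia.
  + apply ER_le_trans with (1 := h2 t ht ht0); apply ER_add_le; apply hmono; trivial; lia.
- intros t ht.
  pose proof (ER_lt_le_trans _ _ _ hc (midcost_le _ x y t hS hx hy ht)) as hlt.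
  apply ER_lt_add in hlt; destruct hlt as [c1 [c2 [h1 [h2 hcc]]]].
  apply lt_cost_sup in h1, h2; destruct h1 as [n1 h1], h2 as [n2 h2].
  set (n := max n1 n2).
  assert (hlt : ER_lt (Fin c) (ER_add (G n t x) (G n t y))).
  { apply ER_lt_add; exists c1, c2; split; [|split; trivial].
    - apply ER_lt_le_trans with (1 := h1); apply hmono; trivial; unfold n; lia.
    - apply ER_lt_le_trans with (1 := h2); apply hmono; trivial; unfold n; lia. }
  destruct (cost_sum_lsc (G n) x y t c (hG n) hx hy ht hlt) as [d [hd h]].
  exists d; split; trivial; exists n; intros t' [_ at'] ht'.
  apply h; trivial; rewrite Rminus_diag, Rabs_R0; lra.
- exists n; apply midcost_ge_bounded with (b := b); trivial; try lra.
  intros t ht; apply h; lra.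
Qed.

(** One inequality is the exchange above, the other is G n <= G (n + 1) = [midstep a (G n)] and
    monotonicity of [midstep]. *)
Lemma midstep_sup a G x y :
  cost (G 0%nat) ->
  (forall n x y, 0 <= x -> 0 <= y -> ER_le (G n x y) (G (S n) x y)) ->
  (forall n, G (S n) = midstep a (G n)) -> 0 <= x -> 0 <= y ->
  midstep a (cost_sup G) x y = cost_sup G x y.
Proof.
intros hG0 hinc hstep hx hy.
assert (hG : forall n, cost (G n)).
{ intros n; induction n; trivial; rewrite hstep; now apply midstep_cost. }
pose proof (cost_sup_cost G hG) as hS.
apply ER_le_antisym.
- apply ER_le_of_lt; intros c hc; apply ER_lt_scal in hc; [|apply jensen_const_pos].
  apply midcost_sup_lt in hc; trivial; destruct hc as [n hn].
  apply ER_le_trans with (2 := cost_sup_ub G (S n) x y); rewrite hstep.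
  apply ER_scal_le with (1 := jensen_const_pos a) in hn; simpl in hn.
  replace (jensen_const a * (c / jensen_const a)) with c in hn; trivial.
  field; pose proof (jensen_const_pos a); lra.
- apply cost_sup_least; intros n.
  apply ER_le_trans with (1 := hinc n x y hx hy); rewrite hstep.
  apply midstep_mono; trivial; intros; apply cost_sup_ub.
Qed.

(** * Rigidity of metric fixed points *)

Section Rigidity.

Variables (a : R) (G : R -> R -> ER).
Hypothesis ha : 0 < a < 1.
Hypothesis hG : cost G.
Hypothesis hmet : ER_metric (fun x y => ER_pow (G x y) a).
Hypothesis hfix : forall s, 0 <= s -> midstep a G 1 s = G 1 s.

Let g x y := toR (G x y).
Let d x y := rpow (g x y) a.

Lemma metric_cost_fin x y : 0 <= x -> 0 <= y -> G x y = Fin (g x y).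
Proof. now apply ER_metric_finite with a. Qed.

Lemma metric_cost_nonneg x y : 0 <= x -> 0 <= y -> 0 <= g x y.
Proof.
intros hx hy; pose proof (cost_nonneg G hG x y hx hy) as h.
now rewrite metric_cost_fin in h.
Qed.

Lemma metric_cost_sym x y : 0 <= x -> 0 <= y -> d x y = d y x.
Proof. intros hx hy; unfold d, g; now rewrite cost_sym. Qed.

Lemma metric_cost_triangle x y z : 0 <= x -> 0 <= y -> 0 <= z -> d x z <= d x y + d y z.
Proof. intros hx hy hz; unfold d, g; rewrite <- !toR_ER_pow; now apply hmet. Qed.

Lemma metric_cost_hom t x y : 0 < t -> 0 <= x -> 0 <= y ->
  d (t * x) (t * y) = rpow t a * d x y.
Proof.
intros ht hx hy; unfold d, g; rewrite cost_hom, metric_cost_fin by trivial; simpl.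
apply rpow_mult; [lra|now apply metric_cost_nonneg].
Qed.

Lemma metric_cost_axis x : 0 <= x -> d 0 x = rpow x a * d 0 1.
Proof.
intros [hx|<-].
- rewrite <- metric_cost_hom by lra; now rewrite Rmult_0_r, Rmult_1_r.
- rewrite rpow_0, Rmult_0_l; unfold d, g; rewrite cost_diag by (trivial; lra); apply rpow_0.
Qed.

Lemma metric_cost_axis_pos : 0 < d 0 1.
Proof.
destruct (rpow_nonneg (g 0 1) a) as [h|h]; trivial; exfalso.
enough (0 = 1) by lra.
apply hmet; try lra; rewrite toR_ER_pow; now symmetry.
Qed.

(** At a minimiser [t] the fixed-point equation closes the chain of the triangle inequality and
    [rpow_add_le], so both are equalities; the equality case gives [g t 1 = g t s]. *)
Lemma metric_midpoint s : 0 <= s ->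
  exists t, 0 <= t /\ d t 1 = d 1 s / 2 /\ d t s = d 1 s / 2.
Proof.
intros hs.
pose proof (jensen_const_pos a) as hk.
pose proof (hfix s hs) as e; unfold midstep in e.
rewrite (metric_cost_fin 1 s) in e by lra.
destruct (midcost G 1 s) as [v|] eqn:ev; [|discriminate]; simpl in e.
injection e; clear e; intros e.
apply midcost_attained in ev; trivial; try lra; destruct ev as [t [ht ev]].
rewrite !metric_cost_fin in ev by lra; simpl in ev; injection ev; clear ev; intros ev.
pose proof (metric_cost_triangle 1 t s Rle_0_1 ht hs) as htri.
rewrite (metric_cost_sym 1 t) in htri by lra.
pose proof (metric_cost_nonneg t 1 ht Rle_0_1) as h1.
pose proof (metric_cost_nonneg t s ht hs) as h2.
assert (heq : g t 1 = g t s).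
{ apply rpow_add_eq with a; trivial; rewrite ev, e; apply htri. }
assert (hd : d 1 s = 2 * d t 1).
{ unfold d at 1; rewrite <- e, <- ev, <- heq.
  replace (g t 1 + g t 1) with (2 * g t 1) by ring; apply rpow_jensen_const; lra. }
exists t; split; trivial; unfold d at 3; rewrite <- heq; fold (d t 1); lra.
Qed.

(* The points x of [0, 1] on a geodesic from 0 to 1. *)
Let T x := 0 <= x <= 1 /\ d x 1 <= d 0 1 * (1 - rpow x a).

Lemma geodesic_0 : T 0.
Proof. split; [lra|rewrite rpow_0; lra]. Qed.

Lemma geodesic_1 : T 1.
Proof.
split; [lra|]; unfold d at 1, g; rewrite cost_diag, rpow_1 by (trivial; lra).
simpl; rewrite rpow_0; lra.
Qed.

(** Scaling by [x] turns the bound on d(y, 1) into one on d(x y, x); the triangle inequality through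
    [x] then adds the two. Homogeneity requires a positive factor, hence the case x = 0. *)
Lemma geodesic_mult x y : T x -> T y -> T (x * y).
Proof.
intros [hx hdx] [hy hdy]; split; [nra|].
destruct (Req_dec x 0) as [->|hx0].
{ rewrite Rmult_0_l, rpow_0; lra. }
assert (hxy : 0 <= x * y) by (apply Rmult_le_pos; lra).
pose proof (metric_cost_triangle (x * y) x 1 hxy ltac:(lra) Rle_0_1) as h.
assert (e : d (x * y) x = rpow x a * d y 1).
{ rewrite <- metric_cost_hom by lra; now rewrite Rmult_1_r. }
rewrite rpow_mult by lra; rewrite e in h.
pose proof (Rmult_le_compat_l _ _ _ (rpow_nonneg x a) hdy); nra.
Qed.

Lemma geodesic_midpoint x : T x -> exists y, T y /\ rpow y a = (1 + rpow x a) / 2.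
Proof.
intros [hx hdx]; destruct (metric_midpoint x) as [t [ht [h1 h2]]]; [lra|].
rewrite (metric_cost_sym 1 x) in h1, h2 by lra.
pose proof metric_cost_axis_pos as hc.
pose proof (metric_cost_triangle 0 t 1 (Rle_refl 0) ht Rle_0_1) as k1.
pose proof (metric_cost_triangle 0 x t (Rle_refl 0) ltac:(lra) ht) as k2.
rewrite (metric_cost_sym x t) in k2 by lra.
rewrite (metric_cost_axis t) in k1, k2 by trivial.
rewrite (metric_cost_axis x) in k2 by lra.
(* The triangle inequality from 0 through [t] to 1 bounds t^a from below, the one from 0 through [x]
   to [t] from above, by the same number. *)
assert (e : rpow t a = (1 + rpow x a) / 2).
{ apply Rle_antisym; apply Rmult_le_reg_r with (1 := hc); lra. }
exists t; split; trivial; split.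
- split; trivial; apply rpow_le_inv with a; try lra; rewrite e, rpow_1.
  enough (rpow x a <= rpow 1 a) by (rewrite rpow_1 in *; lra).
  apply rpow_le; lra.
- rewrite e; lra.
Qed.

(** Starting from 0, each midpoint with 1 halves 1 - y^a. *)
Lemma geodesic_dyadic n : exists y, T y /\ rpow y a = 1 - (/ 2) ^ n.
Proof.
induction n as [|n [x [hx ex]]].
- exists 0; split; [apply geodesic_0|rewrite rpow_0; simpl; lra].
- destruct (geodesic_midpoint x hx) as [y [hy ey]].
  exists y; split; trivial; rewrite ey, ex; simpl; lra.
Qed.

Lemma geodesic_near_1 eps : 0 < eps < 1 -> exists r, T r /\ 1 - eps < r < 1.
Proof.
intros he.
assert (h : rpow (1 - eps) a < 1) by (apply rpow_lt_1; lra).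
destruct (pow_lt_1_zero (/ 2)) with (y := 1 - rpow (1 - eps) a) as [n hn].
{ rewrite Rabs_pos_eq; lra. }
{ lra. }
specialize (hn n (le_n n)).
assert (hp : 0 < (/ 2) ^ n) by (apply pow_lt; lra).
rewrite Rabs_pos_eq in hn by lra.
destruct (geodesic_dyadic n) as [r [hr er]]; exists r; split; trivial.
destruct hr as [hr _]; split; apply Rnot_le_lt; intros hle.
- enough (rpow r a <= rpow (1 - eps) a) by lra.
  apply rpow_le; lra.
- replace r with 1 in er by lra; rewrite rpow_1 in er; lra.
Qed.

(* Powers of a geodesic point r close to 1 decrease to 0 in steps smaller than 1 - r. *)
Lemma geodesic_dense x eps : 0 <= x < 1 -> 0 < eps < 1 ->
  exists u, T u /\ x <= u <= x + eps.
Proof.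
intros hx he; destruct (geodesic_near_1 eps he) as [r [hr hr1]].
assert (hTp : forall k, T (r ^ k)).
{ intros k; induction k; simpl; [apply geodesic_1|now apply geodesic_mult]. }
apply NNPP; intros hn.
(* If no geodesic point lies in [x, x + eps], the powers cannot step over this interval and all stay
   above it, although they tend to 0. *)
assert (hlow : forall k, x + eps < r ^ k).
{ intros k; induction k as [|k IH].
  - apply Rnot_le_lt; intros h; apply hn; exists 1; simpl in h.
    split; [apply geodesic_1|lra].
  - apply Rnot_le_lt; intros h; apply hn; exists (r ^ S k); split; trivial.
    split; trivial; simpl.
    destruct (hTp k) as [hk _].
    enough ((1 - r) * r ^ k <= (1 - r) * 1) by lra.
    apply Rmult_le_compat_l; lra. }
destruct (pow_lt_1_zero r) with (y := eps) as [n h].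
{ rewrite Rabs_pos_eq; lra. }
{ lra. }
specialize (h n (le_n n)); specialize (hlow n).
apply Rabs_def2 in h; lra.
Qed.

Lemma metric_cost_geodesic x : 0 <= x <= 1 -> d x 1 = d 0 1 * (1 - rpow x a).
Proof.
intros hx.
pose proof metric_cost_axis_pos as hc.
apply Rle_antisym.
2:{ pose proof (metric_cost_triangle 0 x 1) as h.
    rewrite (metric_cost_axis x) in h by lra; lra. }
destruct (Req_dec x 1) as [->|hx1]; [apply geodesic_1|].
assert (hX : rpow x a < 1) by (apply rpow_lt_1; lra).
assert (hw : 0 <= d 0 1 * (1 - rpow x a)) by (apply Rmult_le_pos; lra).
set (w := d 0 1 * (1 - rpow x a)) in *.
(* Writing [w] as a power allows the strict inequality to be stated for [G], whose lower
   semicontinuity is known. *)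
rewrite <- (rpow_Kinv w a) by lra.
apply Rnot_lt_le; intros hlt.
assert (hlt' : ER_lt (Fin (rpow w (1 / a))) (G x 1)).
{ rewrite metric_cost_fin, ER_lt_Fin by lra; apply Rnot_le_lt; intros hle.
  apply Rlt_not_le with (1 := hlt); unfold d.
  apply rpow_le; [lra|split; trivial; apply metric_cost_nonneg; lra]. }
destruct (cost_lsc G hG x 1 ltac:(lra) Rle_0_1 _ hlt') as [e [he h]].
assert (he2 : 0 < Rmin (e / 2) (1 / 2)) by (apply Rmin_pos; lra).
(* The geodesic point [u] lies to the right of [x], so 1 - u^a <= 1 - x^a, and d(u, 1) cannot exceed
   [w]. *)
destruct (geodesic_dense x (Rmin (e / 2) (1 / 2))) as [u [[hu hdu] hxu]].
{ lra. }
{ pose proof (Rmin_r (e / 2) (1 / 2)); lra. }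
assert (hue : Rabs (u - x) < e).
{ pose proof (Rmin_l (e / 2) (1 / 2)); apply Rabs_def1; lra. }
specialize (h u 1 ltac:(lra) Rle_0_1 hue).
rewrite Rminus_diag, Rabs_R0 in h; specialize (h he).
rewrite metric_cost_fin, ER_lt_Fin in h by lra.
assert (hgu : rpow (rpow w (1 / a)) a < d u 1).
{ apply rpow_lt; [lra|]; split; trivial; apply rpow_nonneg. }
rewrite rpow_Kinv in hgu by lra.
enough (d 0 1 * (1 - rpow u a) <= w) by lra.
apply Rmult_le_compat_l; [lra|].
enough (rpow x a <= rpow u a) by lra.
apply rpow_le; lra.
Qed.

(** The constant is d(0, 1)^(1/a). Values s > 1 reduce to / s in [0, 1] by homogeneity and
    symmetry. *)
Lemma metric_fixed_point_form : exists c, 0 < c /\ forall s, 0 <= s ->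
  G 1 s = Fin (c * rpow (Rabs (rpow s a - 1)) (1 / a)).
Proof.
pose proof metric_cost_axis_pos as hc.
exists (rpow (d 0 1) (1 / a)); split; [now apply rpow_pos|].
intros s hs; rewrite metric_cost_fin by lra; f_equal.
rewrite <- rpow_mult by (try apply Rabs_pos; lra).
rewrite <- (rpow_invK (g 1 s) a) by (try apply metric_cost_nonneg; lra).
f_equal; fold (d 1 s).
rewrite metric_cost_sym by lra.
destruct (Rle_dec s 1) as [h1|h1].
- assert (rpow s a <= 1) by (rewrite <- (rpow_1 a); apply rpow_le; lra).
  rewrite Rabs_left1 by lra; rewrite metric_cost_geodesic by lra; ring.
- assert (1 < rpow s a) by (rewrite <- (rpow_1 a); apply rpow_lt; lra).
  assert (hs' : 0 < / s) by (apply Rinv_0_lt_compat; lra).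
  assert (hs1 : / s <= 1) by (rewrite <- Rinv_1; apply Rinv_le_contravar; lra).
  rewrite Rabs_pos_eq by lra.
  assert (e : d s 1 = rpow s a * d 1 (/ s)).
  { rewrite <- metric_cost_hom by lra; now rewrite Rmult_1_r, Rinv_r by lra. }
  assert (e' : rpow s a * rpow (/ s) a = 1).
  { rewrite <- rpow_mult, Rinv_r by lra; apply rpow_1. }
  rewrite e, metric_cost_sym, metric_cost_geodesic by lra.
  transitivity (d 0 1 * (rpow s a - rpow s a * rpow (/ s) a)); [ring|].
  rewrite e'; ring.
Qed.

End Rigidity.

(** * Convergence of the iterates and form of the limit *)

Theorem mainTheorem9 (a : R) (F : R -> ER) (ha : 0 < a < 1)
  (hF : Gamma0s F)
  (hmet : ER_metric (fun x y => ER_pow (persp F x y) a)) :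
  (forall (n : nat) (s : R), 0 <= s ->
     ER_le (Ta_iter a n F s) (Ta_iter a (S n) F s)) /\
  exists Finf : R -> ER,
    (forall s, 0 <= s -> ER_seq_lim (fun n => Ta_iter a n F s) (Finf s)) /\
    (forall s, 0 <= s -> Ta a Finf s = Finf s) /\
    (ER_metric (fun x y => ER_pow (persp Finf x y) a) ->
     exists c, 0 < c /\
       forall s, 0 <= s -> Finf s = Fin (c * rpow (Rabs (rpow s a - 1)) (1 / a))).
Proof.
destruct hF as [hF _].
assert (hG0 : cost (persp F)) by (apply persp_is_cost with a; trivial; lra).
set (G := fun n => Nat.iter n (midstep a) (persp F)).
assert (hG : forall n, cost (G n)).
{ intros n; induction n; simpl; trivial; now apply midstep_cost. }
assert (hT : forall n s, 0 <= s -> Ta_iter a n F s = G n 1 s).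
{ intros n; induction n as [|n IH]; intros s hs; simpl.
  - rewrite (cost_sym _ hG0) by lra; symmetry; apply persp_1_r.
  - now apply Ta_midstep. }
(* The metric hypothesis gives the first inequality; monotonicity of [midstep] carries it to all
   later iterates. *)
assert (hinc : forall n x y, 0 <= x -> 0 <= y -> ER_le (G n x y) (G (S n) x y)).
{ intros n; induction n as [|n IH]; intros x y hx hy.
  - now apply le_midstep.
  - exact (midstep_mono a (G n) (G (S n)) x y (hG n) (hG (S n)) IH hx hy). }
assert (hS : cost (cost_sup G)) by now apply cost_sup_cost.
assert (hfix : forall s, 0 <= s -> midstep a (cost_sup G) 1 s = cost_sup G 1 s).
{ intros s hs; apply midstep_sup; trivial; lra. }
assert (hlimT : forall n s, 0 <= s -> ER_le (Ta_iter a n F s) (Ta_iter a (S n) F s)).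
{ intros n s hs; rewrite !hT by trivial; apply hinc; lra. }
split; trivial.
exists (cost_sup G 1); split; [|split].
- intros s hs; apply ER_seq_lim_increasing; [intros n; now apply hlimT|].
  destruct (cost_supP G 1 s) as [h1 h2]; split.
  + intros v [n ->]; rewrite hT by trivial; apply h1; now exists n.
  + intros m hm; apply h2; intros v [n ->]; apply hm; exists n; now rewrite hT.
- intros s hs; rewrite (Ta_midstep a _ (cost_sup G)) by trivial; now apply hfix.
- intros hm; apply metric_fixed_point_form; trivial.
  (* The two functions agree only on the quadrant, so the metric property is transferred clause by
     clause. *)
  assert (hp : forall x y, 0 <= x -> 0 <= y ->
    persp (cost_sup G 1) x y = cost_sup G x y) by (intros; now apply persp_cost).
  destruct hm as [m1 [m2 [m3 [m4 m5]]]].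
  split; [|split; [|split; [|split]]].
  + intros x y hx hy; rewrite <- hp by trivial; now apply m1.
  + intros x y hx hy; rewrite <- hp by trivial; now apply m2.
  + intros x y hx hy; rewrite <- hp by trivial; now apply m3.
  + intros x y hx hy; rewrite <- !hp by trivial; now apply m4.
  + intros x y z hx hy hz; rewrite <- !hp by trivial; now apply m5.
Qed.
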